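(* For a weakly coupled POMDP and horizon $T$, the linear relaxation of the MILP (IP) is a relaxation of the MDP approximation of the weakly coupled POMDP: from any feasible solution of the MDP approximation LP one can build a feasible solution of the linear relaxation of (IP) with the same objective value. Furthermore $v^*_{\mathrm{MDP}}\le z_{\mathrm R}$ and $v^*_{\mathrm{his}}\le z_{\mathrm R^{\mathrm c}}\le z_{\mathrm R}$.
   Context: Weakly coupled POMDP: components $m\in[M]$, each a POMDP $(\mathcal X_S^m,\mathcal X_O^m,\mathcal X_A^m,\mathfrak p^m,\mathbf r^m)$ with initial distribution $p^m(s)$, emissions $p^m(o|s)$, transitions $p^m(s'|s,a)$, reward $r^m(s,a,s')$; functions $\mathbf D^m:\mathcal X_A^m\to\mathbb R^q$ and $\mathbf b\in\mathbb R^q_{\ge0}$. The full system is the POMDP with $\mathcal X_S=\prod_m\mathcal X_S^m$, $\mathcal X_O=\prod_m\mathcal X_O^m$, action space $\mathcal X_A=\{\mathbf a\in\prod_m\mathcal X_A^m:\sum_m\mathbf D^m(a^m)\le\mathbf b\}$ (assumed nonempty), $p(\mathbf s)=\prod_m p^m(s^m)$, $p(\mathbf o|\mathbf s)=\prod_m p^m(o^m|s^m)$, $p(\mathbf s'|\mathbf s,\mathbf a)=\prod_m p^m(s'^m|s^m,a^m)$, $r(\mathbf s,\mathbf a,\mathbf s')=\sum_m r^m(s^m,a^m,s'^m)$. $v^*_{\mathrm{his}}$ is the maximum over history-dependent policies $\delta^t_{\mathbf a|\mathbf h}$ (distributions on $\mathcal X_A$ given the history $\mathbf h=(\mathbf o_1,\mathbf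 a_1,\dots,\mathbf o_t)$) of $\mathbb E_\delta[\sum_{t=1}^T r(\mathbf S_t,\mathbf A_t,\mathbf S_{t+1})]$. For a POMDP $(\mathcal X_S,\mathcal X_O,\mathcal X_A,\mathfrak p)$, $\mathcal Q^{\mathrm d}(T,\mathcal X_S,\mathcal X_O,\mathcal X_A,\mathfrak p)$ is the set of $(\tau,\delta)$, $\delta^t_{a|o}\in\{0,1\}$ with $\sum_a\delta^t_{a|o}=1$, and nonnegative $\tau=((\tau^1_s),(\tau^t_{soa}),(\tau^t_{sas'}))$ with (i) $\tau^1_s=p(s)$; (ii) $\sum_{o,a}\tau^t_{soa}=\nu^t_s$, $\nu^1_s=\tau^1_s$, $\nu^t_s=\sum_{s'',a''}\tau^{t-1}_{s''a''s}$ ($t\ge2$); (iii) $\sum_{\bar s}\tau^t_{sa\bar s}=\sum_o\tau^t_{soa}$; (iv) $\tau^t_{sas'}=p(s'|s,a)\sum_{\bar s}\tau^t_{sa\bar s}$; (McCormick) $\tau^t_{soa}\le p(o|s)\nu^t_s$, $\tau^t_{soa}\le\delta^t_{a|o}$, $\tau^t_{soa}\ge p(o|s)\nu^t_s+\delta^t_{a|o}-1$. MILP (IP): maximize $\sum_t\sum_m\sum_{s,a,s'}r^m(s,a,s')\tau^{t,m}_{sas'}$ s.t. $(\tau^m,\delta^m)\in\mathcal Q^{\mathrm d}(T,\mathcal X_S^m,\mathcal X_O^m,\mathcal X_A^m,\mathfrak p^m)$ for all $m$, $\tau^{t,m}_a=\sum_{s,o}\tau^{t,m}_{soa}$, and $\sum_m\sum_{a\in\mathcal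 X_A^m}\mathbf D^m(a)\tau^{t,m}_a\le\mathbf b$ for all $t$. $z_{\mathrm R}$: value of its linear relaxation ($\delta^{t,m}_{a|o}\in[0,1]$). $z_{\mathrm R^{\mathrm c}}$: value of the linear relaxation with, for each $m$ and $t\in\{2,\dots,T\}$, additional nonnegative variables $\tau^{t,m}_{s'a'soa}$ and constraints $\sum_{s',a'}\tau^{t,m}_{s'a'soa}=\tau^{t,m}_{soa}$; $\sum_a\tau^{t,m}_{s'a'soa}=p^m(o|s)p^m(s|s',a')\tau^{t-1,m}_{s'a'}$ where $\tau^{t-1,m}_{s'a'}:=\sum_{\bar s}\tau^{t-1,m}_{s'a'\bar s}$; $\tau^{t,m}_{s'a'soa}=p^m(s|s',a',o)\sum_{\bar s}\tau^{t,m}_{s'a'\bar soa}$ with $p^m(s|s',a',o)=p^m(o|s)p^m(s|s',a')/\sum_{\bar s}p^m(o|\bar s)p^m(\bar s|s',a')$. MDP approximation of the weakly coupled POMDP: the LP maximizing $\sum_t\sum_{\mathbf s,\mathbf a,\mathbf s'}r(\mathbf s,\mathbf a,\mathbf s')\mu^t_{\mathbf s\mathbf a\mathbf s'}$ over nonnegative $\mu^1_{\mathbf s},\mu^t_{\mathbf s\mathbf a\mathbf s'}$ ($\mathbf a\in\mathcal X_A$) with $\mu^1_{\mathbf s}=p(\mathbf s)$, $\sum_{\mathbf a,\mathbf s'}\mu^1_{\mathbf s\mathbf a\mathbf s'}=\mu^1_{\mathbf s}$, $\sum_{\mathbf a,\mathbf s'}\mu^t_{\mathbf s\mathbf a\mathbf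 s'}=\sum_{\mathbf s'',\mathbf a''}\mu^{t-1}_{\mathbf s''\mathbf a''\mathbf s}$ ($t\ge2$), $\mu^t_{\mathbf s\mathbf a\mathbf s'}=p(\mathbf s'|\mathbf s,\mathbf a)\sum_{\bar{\mathbf s}}\mu^t_{\mathbf s\mathbf a\bar{\mathbf s}}$; value $v^*_{\mathrm{MDP}}$. *)

(* Defs.v *)
From HB Require Import structures.
From mathcomp Require Import all_boot all_order all_algebra.
From mathcomp Require Import classical_sets reals constructive_ereal ereal.
Set Implicit Arguments. Unset Strict Implicit. Unset Printing Implicit Defensive.
Import Order.TTheory GRing.Theory Num.Theory.
Local Open Scope ring_scope.

(* Single-component POMDP polytope (linear relaxation of Q^d) and the extra *)
(* constraints of R^c.  Time is 1-based: t ranges over 1 <= t <= T.         *)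
(* tau1 s = tau^1_s ; tsoa t s o a = tau^t_{soa} ; tsas t s a s' =          *)
(* tau^t_{sas'} ; del t a o = delta^t_{a|o}.                                *)
Section Component.
Variable R : realType.
Variables (S O A : finType).
Variables (p0 : S -> R) (pe : S -> O -> R) (pt : S -> A -> S -> R).
Variable T : nat.

Definition nu (tau1 : S -> R) (tsas : nat -> S -> A -> S -> R) (t : nat) (s : S)
  : R :=
  if t == 1%N then tau1 s
  else \sum_(s'' : S) \sum_(a'' : A) tsas t.-1 s'' a'' s.

(* (tau, delta) in Q^d with the integrality of delta relaxed to [0,1] *)
Definition QR_feasible (tau1 : S -> R) (tsoa : nat -> S -> O -> A -> R)
    (tsas : nat -> S -> A -> S -> R) (del : nat -> A -> O -> R) : Prop :=
  (forall s, tau1 s = p0 s /\ 0 <= tau1 s) /\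
      (forall t, (1 <= t <= T)%N -> forall s o a, 0 <= tsoa t s o a) /\
      (forall t, (1 <= t <= T)%N -> forall s a s', 0 <= tsas t s a s') /\
      (forall t, (1 <= t <= T)%N -> forall s,
         \sum_(o : O) \sum_(a : A) tsoa t s o a = nu tau1 tsas t s) /\
      (forall t, (1 <= t <= T)%N -> forall s a,
         \sum_(sb : S) tsas t s a sb = \sum_(o : O) tsoa t s o a) /\
      (forall t, (1 <= t <= T)%N -> forall s a s',
         tsas t s a s' = pt s a s' * \sum_(sb : S) tsas t s a sb) /\
      (forall t, (1 <= t <= T)%N -> forall s o a,
         [/\ tsoa t s o a <= pe s o * nu tau1 tsas t s,
             tsoa t s o a <= del t a o &
             pe s o * nu tau1 tsas t s + del t a o - 1 <= tsoa t s o a]) /\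
      (forall t, (1 <= t <= T)%N -> forall o, \sum_(a : A) del t a o = 1) /\
      (forall t, (1 <= t <= T)%N -> forall a o, 0 <= del t a o <= 1).

(* p(s | s', a', o); MathComp convention x / 0 = 0 (harmless) *)
Definition pcond (s' : S) (a' : A) (o : O) (s : S) : R :=
  pe s o * pt s' a' s / \sum_(sb : S) pe sb o * pt s' a' sb.

Definition Rc_extra (tsoa : nat -> S -> O -> A -> R)
    (tsas : nat -> S -> A -> S -> R)
    (tc : nat -> S -> A -> S -> O -> A -> R) : Prop :=
  forall t, (2 <= t <= T)%N ->
  [/\ (forall s' a' s o a, 0 <= tc t s' a' s o a),
      (forall s o a, \sum_(s' : S) \sum_(a' : A) tc t s' a' s o a = tsoa t s o a),
      (forall s' a' s o, \sum_(a : A) tc t s' a' s o a =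
           pe s o * pt s' a' s * \sum_(sb : S) tsas t.-1 s' a' sb) &
      (forall s' a' s o a, tc t s' a' s o a =
           pcond s' a' o s * \sum_(sb : S) tc t s' a' sb o a)].

End Component.

Section WeaklyCoupled.
Variable R : realType.
Variable M : nat.
Variables (S O A : 'I_M -> finType).
Variables (p0 : forall m, S m -> R) (pe : forall m, S m -> O m -> R)
          (pt : forall m, S m -> A m -> S m -> R)
          (r : forall m, S m -> A m -> S m -> R).
Variable q : nat.
Variables (D : forall m, A m -> 'I_q -> R) (b : 'I_q -> R).
Variable T : nat.

Definition JS := {dffun forall m : 'I_M, S m}.
Definition JO := {dffun forall m : 'I_M, O m}.
Definition JA := {dffun forall m : 'I_M, A m}.

Definition feasA (a : JA) : bool :=
  [forall i : 'I_q, \sum_(m < M) D (a m) i <= b i].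

Definition jp0 (s : JS) : R := \prod_(m < M) p0 (s m).
Definition jpe (s : JS) (o : JO) : R := \prod_(m < M) pe (s m) (o m).
Definition jpt (s : JS) (a : JA) (s' : JS) : R :=
  \prod_(m < M) pt (s m) (a m) (s' m).
Definition jr (s : JS) (a : JA) (s' : JS) : R :=
  \sum_(m < M) r (s m) (a m) (s' m).

Definition relax_feasible (tau1 : forall m, S m -> R)
    (tsoa : forall m, nat -> S m -> O m -> A m -> R)
    (tsas : forall m, nat -> S m -> A m -> S m -> R)
    (del : forall m, nat -> A m -> O m -> R) : Prop :=
  (forall m, QR_feasible (p0 (m:=m)) (pe (m:=m)) (pt (m:=m)) T
                         (tau1 m) (tsoa m) (tsas m) (del m)) /\
  (forall t, (1 <= t <= T)%N -> forall i : 'I_q,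
     \sum_(m < M) \sum_(x : A m)
        D x i * (\sum_(s : S m) \sum_(o : O m) tsoa m t s o x) <= b i).

Definition relax_obj (tsas : forall m, nat -> S m -> A m -> S m -> R) : R :=
  \sum_(1 <= t < T.+1) \sum_(m < M)
    \sum_(s : S m) \sum_(a : A m) \sum_(s' : S m) r s a s' * tsas m t s a s'.

Definition z_R : \bar R :=
  ereal_sup [set z%:E | z in [set z : R | exists tau1 tsoa tsas del,
     relax_feasible tau1 tsoa tsas del /\ z = relax_obj tsas]].

Definition z_Rc : \bar R :=
  ereal_sup [set z%:E | z in [set z : R | exists tau1 tsoa tsas del tc,
     [/\ relax_feasible tau1 tsoa tsas del,
         (forall m, Rc_extra (pe (m:=m)) (pt (m:=m)) T (tsoa m) (tsas m) (tc m)) &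
         z = relax_obj tsas]]].

(* ---- MDP approximation LP (variables only for a in X_A) ---- *)
Definition mdp_feasible (mu1 : JS -> R) (mu : nat -> JS -> JA -> JS -> R)
  : Prop :=
  [/\ (forall s, mu1 s = jp0 s /\ 0 <= mu1 s),
      (forall t, (1 <= t <= T)%N -> forall s a s', feasA a -> 0 <= mu t s a s'),
      (forall s, \sum_(a | feasA a) \sum_(s' : JS) mu 1%N s a s' = mu1 s),
      (forall t, (2 <= t <= T)%N -> forall s,
         \sum_(a | feasA a) \sum_(s' : JS) mu t s a s' =
         \sum_(s'' : JS) \sum_(a'' | feasA a'') mu t.-1 s'' a'' s) &
      (forall t, (1 <= t <= T)%N -> forall s a s', feasA a ->
         mu t s a s' = jpt s a s' * \sum_(sb : JS) mu t s a sb)].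

Definition mdp_obj (mu : nat -> JS -> JA -> JS -> R) : R :=
  \sum_(1 <= t < T.+1) \sum_(s : JS) \sum_(a | feasA a) \sum_(s' : JS)
     jr s a s' * mu t s a s'.

Definition v_MDP : \bar R :=
  ereal_sup [set z%:E | z in [set z : R | exists mu1 mu,
     mdp_feasible mu1 mu /\ z = mdp_obj mu]].

(* ---- history-dependent policies (time 0-based here: u : 'I_T is period
   u+1).  pol u o a x = delta^{u+1}(x | h) where h consists of o_0..o_u and
   a_0..a_{u-1} of the (observation, action) sequences o, a. ---- *)
Definition his_policy
    (pol : 'I_T -> {ffun 'I_T -> JO} -> {ffun 'I_T -> JA} -> JA -> R) : Prop :=
  [/\ (forall u o a x, 0 <= pol u o a x),
      (forall u o a x, ~~ feasA x -> pol u o a x = 0),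
      (forall u o a, \sum_(x : JA) pol u o a x = 1) &
      (forall (u : 'I_T) (o o' : {ffun 'I_T -> JO}) (a a' : {ffun 'I_T -> JA}),
         (forall w : 'I_T, (w <= u)%N -> o w = o' w) ->
         (forall w : 'I_T, (w < u)%N -> a w = a' w) ->
         pol u o a =1 pol u o' a')].

Definition his_value
    (pol : 'I_T -> {ffun 'I_T -> JO} -> {ffun 'I_T -> JA} -> JA -> R) : R :=
  \sum_(s : {ffun 'I_T.+1 -> JS}) \sum_(o : {ffun 'I_T -> JO})
  \sum_(a : {ffun 'I_T -> JA})
    (jp0 (s ord0) *
     \prod_(u < T) (jpe (s (widen_ord (leqnSn T) u)) (o u) * pol u o a (a u) *
                    jpt (s (widen_ord (leqnSn T) u)) (a u) (s (lift ord0 u))))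
    * \sum_(u < T) jr (s (widen_ord (leqnSn T) u)) (a u) (s (lift ord0 u)).

Definition v_his : \bar R :=
  ereal_sup [set z%:E | z in [set z : R | exists pol,
     his_policy pol /\ z = his_value pol]].

End WeaklyCoupled.

(* Main.v *)
Require Import Defs.
From HB Require Import structures.
From mathcomp Require Import all_boot all_order all_algebra.
From mathcomp Require Import classical_sets reals constructive_ereal ereal.
From mathcomp Require Import lra.
Import Order.TTheory GRing.Theory Num.Theory.
Local Open Scope ring_scope.
Set Implicit Arguments. Unset Strict Implicit. Unset Printing Implicit Defensive.

(** The single-component marginals of a feasible [mu] of the MDP approximation
    satisfy every constraint on [tau_sas], because the transition kernels
    multiply over the components; the resource constraint holds because it is an
    average of the constraints defining the joint action space.  With
    [tau_soa = p(o|s) tau_sa], and [delta^t_{a|o}] the conditional probability of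
    [a] given [o] under [tau^t], the McCormick inequalities hold.

    A history-dependent policy induces a law on trajectories whose
    (state, action, next state) marginals are feasible for the MDP approximation
    with the same value.  Taking for [tau_soa] and [tau_s'a'soa] the marginals of
    the trajectory law, the extra equality of R^c says that [S_t^m] and [A_t^m]
    are conditionally independent given [(S_{t-1}^m, A_{t-1}^m, O_t^m)]: the
    action sees the state of component [m] only through the observations, and
    the other components evolve independently. *)

(** * Sums of products over dependent function spaces *)

Lemma sum_dffun_prod (R : comNzRingType) (I : finType) (X : I -> finType)
    (F : forall i, X i -> R) :
  \sum_(f : {dffun forall i, X i}) \prod_i F i (f i) = \prod_i \sum_x F i x.
Proof.
rewrite (reindex (@dffun_of_fprod _ X)); last exact/onW_bij/dffun_of_fprod_bij.
pose P i : {ffun X i -> R} := [ffun x => F i x].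
transitivity (\sum_(t : fprod X) \prod_(i in I) P i (t i)).
  by apply: eq_bigr => t _; apply: eq_bigr => i _; rewrite !ffunE.
rewrite big_fprod.
rewrite -(bigA_distr_big_dep (tagged_with X) (fun i => untag 0 (P i))).
apply: eq_bigr => i _; rewrite -(big_tag (fun i => P i)).
by apply: eq_bigr => x _; rewrite ffunE.
Qed.

(** The constraint on coordinate [i] is absorbed into factor [i] by making that factor vanish off
    [x]. Comparing [Tagged] elements lets [G j] test against [x : X i] without a cast along
    [j = i]. *)
Lemma sum_dffun_prod_fix (R : comNzRingType) (I : finType) (X : I -> finType)
    (F : forall i, X i -> R) (i : I) (x : X i) :
  \sum_(f : {dffun forall i, X i} | f i == x) \prod_j F j (f j) =
  F i x * \prod_(j | j != i) \sum_y F j y.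
Proof.
pose G j y := (if (j == i) ==> (Tagged X y == Tagged X x) then F j y else 0).
transitivity (\sum_(f : {dffun forall i, X i}) \prod_j G j (f j)).
  rewrite big_mkcond; apply: eq_bigr => f _; rewrite (bigD1 i) //=.
  rewrite [in RHS](bigD1 i) //= {1}/G eqxx eq_Tagged /=.
  case: ifP => _; last by rewrite mul0r.
  by congr (_ * _); apply: eq_bigr => j ji; rewrite /G (negPf ji).
rewrite sum_dffun_prod (bigD1 i) //=; congr (_ * _).
  rewrite (bigD1 x) //= {1}/G !eqxx big1 ?addr0 // => y yx.
  by rewrite /G eqxx eq_Tagged (negPf yx).
by apply: eq_bigr => j ji; apply: eq_bigr => y _; rewrite /G (negPf ji).
Qed.

(** * Completing the marginals of one component by decision variables *)

Section Component.
Variables (R : realType) (S O A : finType).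
Variables (p0 : S -> R) (pe : S -> O -> R) (pt : S -> A -> S -> R) (T : nat).
Hypothesis p0P : (forall s, 0 <= p0 s) /\ \sum_s p0 s = 1.
Hypothesis peP : forall s, (forall o, 0 <= pe s o) /\ \sum_o pe s o = 1.
Hypothesis ptP :
  forall s a, (forall s', 0 <= pt s a s') /\ \sum_s' pt s a s' = 1.

(** Total mass 1 gives [po <= 1], so dividing by it only enlarges: [tsoa <= pao <= del]. Apart from
    the bound by [pe * nu], which is nonnegativity of the other terms, the McCormick inequalities
    come from this chain. *)
Lemma QR_feasible_of_joint (tsoa : nat -> S -> O -> A -> R)
    (tsas : nat -> S -> A -> S -> R) (a0 : A) :
  (forall t, (1 <= t <= T)%N -> forall s o a, 0 <= tsoa t s o a) ->
  (forall t, (1 <= t <= T)%N -> forall s a,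
     \sum_sb tsas t s a sb = \sum_o tsoa t s o a) ->
  (forall t, (1 <= t <= T)%N -> forall s a s',
     tsas t s a s' = pt s a s' * \sum_sb tsas t s a sb) ->
  (forall t, (1 <= t <= T)%N -> forall s o,
     \sum_a tsoa t s o a = pe s o * nu p0 tsas t s) ->
  exists del, QR_feasible p0 pe pt T p0 tsoa tsas del.
Proof.
move=> tsoa0 tsasE tsas_pt tsoa_nu.
pose po t o := \sum_s \sum_a tsoa t s o a.
pose pao t a o := \sum_s tsoa t s o a.
(* P(a | o), and an arbitrary distribution when o has probability 0 *)
pose del t a o := if po t o == 0 then (a == a0)%:R else pao t a o / po t o.
have nuE t : (1 <= t <= T)%N -> forall s,
    \sum_o \sum_a tsoa t s o a = nu p0 tsas t s.
  move=> tT s; under eq_bigr do rewrite tsoa_nu //.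
  by rewrite -mulr_suml (peP s).2 mul1r.
(* [tsas] and [tsoa] have equal mass in each period, so the mass 1 of [p0] reaches every period. *)
have nu1 t : (1 <= t <= T)%N -> \sum_s nu p0 tsas t s = 1.
  elim: t => // -[_ _|t IH tT]; first by rewrite /nu eqxx p0P.2.
  have tT' : (1 <= t.+1 <= T)%N by rewrite /= ltnW.
  rewrite -(IH tT'); under [RHS]eq_bigr => s _ do rewrite -(nuE _ tT').
  rewrite /nu /=.
  rewrite exchange_big; apply: eq_bigr => s'' _ /=.
  rewrite exchange_big [RHS]exchange_big; apply: eq_bigr => a _ /=.
  exact: tsasE.
have poE t o : po t o = \sum_a pao t a o by rewrite /po exchange_big.
have pao0 t : (1 <= t <= T)%N -> forall a o, 0 <= pao t a o.
  by move=> tT a o; apply: sumr_ge0 => s _; exact: tsoa0.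
have po0 t : (1 <= t <= T)%N -> forall o, 0 <= po t o.
  by move=> tT o; rewrite poE; apply: sumr_ge0 => a _; exact: pao0.
have po1 t : (1 <= t <= T)%N -> forall o, po t o <= 1.
  move=> tT o; rewrite -(nu1 t tT) /po; apply: ler_sum => s _.
  rewrite -nuE // (bigD1 o) //= lerDl; apply: sumr_ge0 => o' _.
  by apply: sumr_ge0 => a _; exact: tsoa0.
have tsoa_pao t : (1 <= t <= T)%N -> forall s o a, tsoa t s o a <= pao t a o.
  move=> tT s o a; rewrite /pao (bigD1 s) //= lerDl; apply: sumr_ge0 => s' _.
  exact: tsoa0.
have pao_del t : (1 <= t <= T)%N -> forall a o, pao t a o <= del t a o.
  move=> tT a o; rewrite /del; case: eqP => [|/eqP] po_eq.
    rewrite (@le_trans _ _ (po t o)) ?po_eq ?ler0n //.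
    rewrite -po_eq poE (bigD1 a) //= lerDl; apply: sumr_ge0 => a' _.
    exact: pao0.
  rewrite ler_pdivlMr ?lt_neqAle 1?eq_sym ?po_eq ?po0 //.
  by rewrite ler_piMr ?pao0 ?po1.
have del_sum t : (1 <= t <= T)%N -> forall o, \sum_a del t a o = 1.
  move=> tT o; rewrite /del; case: eqP => [|/eqP] po_eq.
    rewrite (bigD1 a0) //= eqxx big1 ?addr0 // => a /negPf -> //.
  by rewrite -mulr_suml -poE divff.
have del0 t : (1 <= t <= T)%N -> forall a o, 0 <= del t a o.
  by move=> tT a o; apply: le_trans (pao0 t tT a o) (pao_del t tT a o).
exists del; refine (conj _ (conj _ (conj _ (conj _ (conj _ (conj _ (conj _
  (conj _ _)))))))) => //.
- by move=> s; split=> //; exact: p0P.1.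
- by move=> t tT s a s'; rewrite tsas_pt // tsasE // mulr_ge0 ?(ptP s a).1 //
    sumr_ge0 // => o _; exact: tsoa0.
- move=> t tT s o a; split.
  + rewrite -tsoa_nu // (bigD1 a) //= lerDl sumr_ge0 // => a' _.
    exact: tsoa0.
  + exact: le_trans (tsoa_pao _ tT _ _ _) (pao_del _ tT _ _).
  (* Writing [pe s o * nu] and 1 as the sums of [tsoa] and [del] over actions and splitting off [a]
     leaves the upper bound summed over the other actions. *)
  + rewrite -tsoa_nu // -(del_sum t tT o) [X in _ - X](bigD1 a) //=.
    rewrite [X in X + _ - _](bigD1 a) //=.
    suff : \sum_(a' | a' != a) tsoa t s o a' <= \sum_(a' | a' != a) del t a' o.
      by lra.
    apply: ler_sum => a' _.
    exact: le_trans (tsoa_pao _ tT _ _ _) (pao_del _ tT _ _).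
- move=> t tT a o; rewrite del0 //= -(del_sum t tT o) (bigD1 a) //= lerDl.
  by rewrite sumr_ge0 // => a' _; exact: del0.
Qed.

End Component.

(** * Sums of indicators *)

Lemma sum_indicator (R : nzSemiRingType) (I : finType) (c : bool) (i : I) :
  \sum_j (c && (i == j))%:R = c%:R :> R.
Proof.
rewrite (bigD1 i) //= eqxx andbT big1 ?addr0 // => j /negPf ji.
by rewrite eq_sym ji andbF.
Qed.

Lemma sum3_indicator (R : nzSemiRingType) (I J K : finType)
    (F : I -> J -> K -> R) i j k :
  \sum_i' \sum_j' \sum_k' F i' j' k' * [&& i == i', j == j' & k == k']%:R =
  F i j k.
Proof.
rewrite (bigD1 i) //= [X in _ + X]big1 ?addr0 => [|i' /negPf ii']; last first.
  by do 2!rewrite big1 // => ? _; rewrite eq_sym ii' mulr0.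
rewrite (bigD1 j) //= [X in _ + X]big1 ?addr0 => [|j' /negPf jj']; last first.
  by rewrite big1 // => ? _; rewrite (eq_sym j) jj' andbF mulr0.
rewrite (bigD1 k) //= [X in _ + X]big1 ?addr0 => [|k' /negPf kk']; last first.
  by rewrite (eq_sym k) kk' !andbF mulr0.
by rewrite !eqxx mulr1.
Qed.

(** * Joint kernels and their component marginals *)

Section WeaklyCoupled.
Variables (R : realType) (M : nat) (S O A : 'I_M -> finType).
Variables (p0 : forall m, S m -> R) (pe : forall m, S m -> O m -> R).
Variables (pt : forall m, S m -> A m -> S m -> R).
Variables (r : forall m, S m -> A m -> S m -> R).
Variables (q : nat) (D : forall m, A m -> 'I_q -> R) (b : 'I_q -> R) (T : nat).
Hypothesis p0P : forall m, (forall s : S m, 0 <= p0 s) /\ \sum_(s : S m) p0 s = 1.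
Hypothesis peP :
  forall m (s : S m), (forall o, 0 <= pe s o) /\ \sum_(o : O m) pe s o = 1.
Hypothesis ptP : forall m (s : S m) (a : A m),
  (forall s', 0 <= pt s a s') /\ \sum_(s' : S m) pt s a s' = 1.
Hypothesis XA_nonempty : exists a : JA A, feasA D b a.

Implicit Types (s : JS S) (o : JO O) (a : JA A).
Notation feas := (feasA D b).

Lemma sum_jp0 : \sum_s jp0 p0 s = 1.
Proof.
by rewrite sum_dffun_prod big1 // => m _; exact: (p0P m).2.
Qed.

Lemma sum_jpe s : \sum_o jpe pe s o = 1.
Proof.
rewrite (sum_dffun_prod (fun m y => pe (s m) y)) big1 // => m _.
exact: (peP (s m)).2.
Qed.

Lemma sum_jpt s a : \sum_s' jpt pt s a s' = 1.
Proof.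
rewrite (sum_dffun_prod (fun m y => pt (s m) (a m) y)) big1 // => m _.
exact: (ptP (s m) (a m)).2.
Qed.

Lemma jp0_ge0 s : 0 <= jp0 p0 s.
Proof. by apply: prodr_ge0 => m _; exact: (p0P m).1. Qed.

Lemma jpe_ge0 s o : 0 <= jpe pe s o.
Proof. by apply: prodr_ge0 => m _; exact: (peP _).1. Qed.

Lemma jpt_ge0 s a s' : 0 <= jpt pt s a s'.
Proof. by apply: prodr_ge0 => m _; exact: (ptP _ _).1. Qed.

Lemma jp0_marginal m (x : S m) : \sum_(s : JS S | s m == x) jp0 p0 s = p0 x.
Proof.
rewrite sum_dffun_prod_fix big1 ?mulr1 // => n _; exact: (p0P n).2.
Qed.

Lemma jpe_marginal m s (x : O m) :
  \sum_(o : JO O | o m == x) jpe pe s o = pe (s m) x.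
Proof.
rewrite (sum_dffun_prod_fix (fun n y => pe (s n) y)) big1 ?mulr1 // => n _.
exact: (peP _).2.
Qed.

Lemma jpt_marginal m s a (x : S m) :
  \sum_(s' : JS S | s' m == x) jpt pt s a s' = pt (s m) (a m) x.
Proof.
rewrite (sum_dffun_prod_fix (fun n y => pt (s n) (a n) y)) big1 ?mulr1 //.
by move=> n _; exact: (ptP _ _).2.
Qed.

(** * Marginals of a feasible point of the MDP approximation *)

Section OfMDP.
Variables (mu1 : JS S -> R) (mu : nat -> JS S -> JA A -> JS S -> R).
Hypothesis muP : mdp_feasible p0 pt D b T mu1 mu.

(** Integration against [mu t] as a linear functional: marginals are its values at indicators, and
    constraints on marginals become identities between integrands. *)
Definition mdp_exp t (F : JS S -> JA A -> JS S -> R) : R :=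
  \sum_s \sum_(a | feas a) \sum_s' mu t s a s' * F s a s'.

Lemma mdp_exp_sum t (I : finType) (F : I -> JS S -> JA A -> JS S -> R) :
  \sum_i mdp_exp t (F i) = mdp_exp t (fun s a s' => \sum_i F i s a s').
Proof.
rewrite exchange_big; apply: eq_bigr => s _ /=.
rewrite exchange_big; apply: eq_bigr => a _ /=.
rewrite exchange_big; apply: eq_bigr => s' _ /=.
by rewrite mulr_sumr.
Qed.

Lemma mdp_expZ t c F :
  c * mdp_exp t F = mdp_exp t (fun s a s' => c * F s a s').
Proof.
rewrite mulr_sumr; apply: eq_bigr => s _; rewrite mulr_sumr.
apply: eq_bigr => a _; rewrite mulr_sumr; apply: eq_bigr => s' _.
by rewrite mulrCA.
Qed.

Lemma eq_mdp_exp t F G : (forall s a s', F s a s' = G s a s') ->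
  mdp_exp t F = mdp_exp t G.
Proof.
move=> FG; apply: eq_bigr => s _; apply: eq_bigr => a _; apply: eq_bigr => s' _.
by rewrite FG.
Qed.

Lemma ler_mdp_exp t F G : (1 <= t <= T)%N ->
  (forall s a s', feas a -> F s a s' <= G s a s') ->
  mdp_exp t F <= mdp_exp t G.
Proof.
case: muP => _ mu0 _ _ _ tT FG; apply: ler_sum => s _; apply: ler_sum => a aF.
by apply: ler_sum => s' _; rewrite ler_wpM2l ?mu0 ?FG.
Qed.

Lemma mdp_exp_flow t (F : JS S -> R) : (2 <= t <= T)%N ->
  mdp_exp t (fun s _ _ => F s) = mdp_exp t.-1 (fun _ _ s' => F s').
Proof.
case: muP => _ _ _ flow _ tT; rewrite /mdp_exp.
under [RHS]eq_bigr do rewrite exchange_big /=.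
rewrite [RHS]exchange_big; apply: eq_bigr => s _ /=.
under eq_bigr do rewrite -mulr_suml; rewrite -mulr_suml flow //.
by rewrite mulr_suml; apply: eq_bigr => s'' _; rewrite mulr_suml.
Qed.

Lemma mdp_exp1 (F : JS S -> R) :
  mdp_exp 1 (fun s _ _ => F s) = \sum_s jp0 p0 s * F s.
Proof.
case: muP => mu1E _ init _ _; apply: eq_bigr => s _.
under eq_bigr do rewrite -mulr_suml.
by rewrite -mulr_suml init (mu1E s).1.
Qed.

(** The mass of [jp0] is 1 and the flow constraint preserves it. This is what makes the left side of
    the resource constraint an average. *)
Lemma mdp_exp_cst t c : (1 <= t <= T)%N -> mdp_exp t (fun _ _ _ => c) = c.
Proof.
elim: t => // -[_ _|t IH tT].
  by rewrite (mdp_exp1 (fun=> c)) -mulr_suml sum_jp0 mul1r.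
by rewrite (mdp_exp_flow (fun=> c)) //= IH //= ltnW.
Qed.

Definition sas_marginal m t (x : S m) (y : A m) (z : S m) : R :=
  mdp_exp t (fun s a s' => [&& s m == x, a m == y & s' m == z]%:R).

Lemma sas_marginal_sum3 m t (x : S m) (y : A m) :
  \sum_z sas_marginal t x y z =
  mdp_exp t (fun s a _ => ((s m == x) && (a m == y))%:R).
Proof.
rewrite mdp_exp_sum; apply: eq_mdp_exp => s a s'.
by under eq_bigr do rewrite andbA; rewrite sum_indicator.
Qed.

Lemma sas_marginal_sum23 m t (x : S m) :
  \sum_y \sum_z sas_marginal t x y z = mdp_exp t (fun s _ _ => (s m == x)%:R).
Proof.
under eq_bigr do rewrite sas_marginal_sum3.
rewrite mdp_exp_sum; apply: eq_mdp_exp => s a s'.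
by rewrite sum_indicator.
Qed.

Lemma sas_marginal_sum13 m t (y : A m) :
  \sum_x \sum_z sas_marginal t x y z = mdp_exp t (fun _ a _ => (a m == y)%:R).
Proof.
under eq_bigr do rewrite sas_marginal_sum3.
rewrite mdp_exp_sum; apply: eq_mdp_exp => s a s'.
by under eq_bigr do rewrite andbC; rewrite sum_indicator.
Qed.

Lemma sas_marginal_sum12 m t (z : S m) :
  \sum_x \sum_y sas_marginal t x y z = mdp_exp t (fun _ _ s' => (s' m == z)%:R).
Proof.
under eq_bigr do rewrite mdp_exp_sum.
rewrite mdp_exp_sum; apply: eq_mdp_exp => s a s'.
under eq_bigr => x _.
  under eq_bigr do rewrite andbCA andbC.
  rewrite sum_indicator andbC; over.
by rewrite sum_indicator.
Qed.

(** The identity already holds for each joint pair [(s, a)] before summation: once [s m = x] and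
    [a m = y], the kernels of the other components sum to 1. *)
Lemma sas_marginal_pt m t (x : S m) (y : A m) (z : S m) : (1 <= t <= T)%N ->
  sas_marginal t x y z = pt x y z * \sum_z' sas_marginal t x y z'.
Proof.
case: muP => _ _ _ _ mu_pt tT; rewrite sas_marginal_sum3 mdp_expZ.
apply: eq_bigr => s _; apply: eq_bigr => a aF; rewrite -mulr_suml.
have [/andP[/eqP sx /eqP ay]|sa] := boolP ((s m == x) && (a m == y)); last first.
  rewrite mulr0 mulr0 big1 // => s' _; case: (s m == x) sa => /= [/negPf ->|];
  by rewrite ?mulr0.
rewrite sx ay !eqxx /= mulr1 -{1}sx -ay -(jpt_marginal s a z).
rewrite mulrC mulr_suml [RHS]big_mkcond; apply: eq_bigr => s' _; rewrite mu_pt //.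
by case: eqP; rewrite ?mulr1 ?mulr0 ?mul0r.
Qed.

(** At time 1 this is the marginal of [jp0]; later it is the joint flow constraint integrated
    against the indicator of [x]. *)
Lemma nu_sas_marginal m t (x : S m) : (1 <= t <= T)%N ->
  nu (@p0 m) (@sas_marginal m) t x = \sum_y \sum_z sas_marginal t x y z.
Proof.
rewrite sas_marginal_sum23 /nu; case: eqP => [-> _|/eqP t1 tT].
  rewrite (mdp_exp1 (fun s => (s m == x)%:R)) -(jp0_marginal x) big_mkcond /=.
  by apply: eq_bigr => s _; case: eqP; rewrite ?mulr1 ?mulr0.
rewrite sas_marginal_sum12 (mdp_exp_flow (fun s => (s m == x)%:R)) //.
by case: t t1 tT => [|[]].
Qed.

Lemma relax_obj_sas_marginal :
  relax_obj r T (fun m => @sas_marginal m) = mdp_obj r D b T mu.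
Proof.
apply: eq_bigr => t _.
transitivity (mdp_exp t (fun s a s' => \sum_m r (s m) (a m) (s' m))).
  rewrite -mdp_exp_sum; apply: eq_bigr => m _.
  under eq_bigr do under eq_bigr do under eq_bigr do rewrite mdp_expZ.
  under eq_bigr do under eq_bigr do rewrite mdp_exp_sum.
  under eq_bigr do rewrite mdp_exp_sum.
  rewrite mdp_exp_sum; apply: eq_mdp_exp => s a s'.
  by rewrite sum3_indicator.
apply: eq_bigr => s _; apply: eq_bigr => a _; apply: eq_bigr => s' _.
by rewrite mulrC.
Qed.

(** [tsoa] is left free because two choices are made: a product with [pe] for a solution of the LP,
    and trajectory marginals for a policy. In the resource constraint the left side is the mean of a
    quantity bounded by [b i] at every feasible joint action. *)
Lemma relax_feasible_sas_marginal
    (tsoa : forall m, nat -> S m -> O m -> A m -> R) :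
  (forall m t, (1 <= t <= T)%N -> forall x y z, 0 <= tsoa m t x y z) ->
  (forall m t, (1 <= t <= T)%N -> forall x z,
     \sum_y tsoa m t x y z = \sum_x' sas_marginal t x z x') ->
  (forall m t, (1 <= t <= T)%N -> forall x y,
     \sum_z tsoa m t x y z = pe x y * \sum_z \sum_x' sas_marginal t x z x') ->
  exists del, relax_feasible p0 pe pt D b T p0 tsoa
                (fun m => @sas_marginal m) del.
Proof.
move=> tsoa0 tsoa_o tsoa_a.
have [a0 _] := XA_nonempty.
have ex m : exists del, QR_feasible (@p0 m) (@pe m) (@pt m) T (@p0 m) (tsoa m)
    (@sas_marginal m) del.
  apply: (QR_feasible_of_joint (p0P m) (@peP m) (@ptP m) (a0 m)).
  - exact: tsoa0.
  - by move=> t tT x y; rewrite tsoa_o.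
  - by move=> t tT x y z; exact: sas_marginal_pt.
  - by move=> t tT x y; rewrite tsoa_a // nu_sas_marginal.
(* Choice turns the decision variables found for each component into one family indexed by [m]. *)
pose del m := sval (boolp.cid (ex m)).
exists del; split=> [m|]; first exact: svalP.
move=> t tT i.
rewrite -[leRHS](mdp_exp_cst (b i) tT).
rewrite [leLHS](_ : _ = mdp_exp t (fun _ a _ => \sum_m D (a m) i)); last first.
  rewrite -mdp_exp_sum; apply: eq_bigr => m _.
  transitivity (\sum_y mdp_exp t (fun _ a _ => D y i * (a m == y)%:R)).
    apply: eq_bigr => y _; rewrite -mdp_expZ -sas_marginal_sum13.
    by congr (_ * _); apply: eq_bigr => x _; rewrite tsoa_o.
  rewrite mdp_exp_sum; apply: eq_mdp_exp => s a s'.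
  rewrite (bigD1 (a m)) //= eqxx mulr1 big1 ?addr0 // => y /negPf ay.
  by rewrite eq_sym ay mulr0.
by apply: ler_mdp_exp => // s a s' /forallP; exact.
Qed.

Lemma mdp_relaxation : exists tsoa del,
  relax_feasible p0 pe pt D b T p0 tsoa (fun m => @sas_marginal m) del.
Proof.
exists (fun m t x y z => pe x y * \sum_x' sas_marginal t x z x').
apply: relax_feasible_sas_marginal => m t tT x => [y z|z|y].
- rewrite mulr_ge0 ?(peP x).1 // sumr_ge0 // => x' _.
  case: muP => _ mu0 _ _ _; apply: sumr_ge0 => s _; apply: sumr_ge0 => a aF.
  by apply: sumr_ge0 => s' _; rewrite mulr_ge0 ?ler0n ?mu0.
- by rewrite -mulr_suml (peP x).2 mul1r.
- by rewrite -mulr_sumr.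
Qed.

End OfMDP.
End WeaklyCoupled.

(** * Path measures built from sequential kernels *)

Section SequentialKernels.
Variables (R : comNzRingType) (T : nat) (W X : finType) (x0 : X).
Variables (proj : 'I_T -> W -> X) (upd : 'I_T -> W -> X -> W).
Variables (ini : W -> R) (kap : 'I_T -> W -> X -> R).
Hypothesis proj_upd : forall u w x, proj u (upd u w x) = x.
Hypothesis proj_upd_neq :
  forall u v w x, v != u -> proj v (upd u w x) = proj v w.
Hypothesis upd_upd : forall u w x y, upd u (upd u w x) y = upd u w y.
Hypothesis updC :
  forall u v w x y, v != u -> upd u (upd v w x) y = upd v (upd u w y) x.
Hypothesis upd_proj : forall u w, upd u w (proj u w) = w.
Hypothesis ini_upd : forall u w x, ini (upd u w x) = ini w.
Hypothesis kap_upd :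
  forall (u v : 'I_T) w x, (v <= u)%N -> kap v (upd u w x) =1 kap v w.
Hypothesis kap1 : forall u w, \sum_x kap u w x = 1.

(** The steps act as independent coordinates of a path, read by [proj] and overwritten by [upd]. The
    hypothesis [kap_upd] is causality: the law of a step ignores that step and all later ones. *)
Definition path_weight w := ini w * \prod_u kap u w (proj u w).

(* The steps from time [k] on are frozen to [x0], so that paths of length [k]
   are summed over without changing the type of paths. *)
Definition pinned_weight (k : nat) w :=
  ini w * \prod_(u < T) (if (u < k)%N then kap u w (proj u w)
                   else (proj u w == x0)%:R).

(** Measurability with respect to the past before step [k]. *)
Definition adapted (k : nat) (G : W -> R) :=
  forall u : 'I_T, (k <= u)%N -> forall w x, G (upd u w x) = G w.

(** Every path arises exactly once by overwriting step [u] of a path that has [x0] there. *)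
Lemma sum_upd u (H : W -> R) :
  \sum_w H w = \sum_(w | proj u w == x0) \sum_x H (upd u w x).
Proof.
rewrite pair_big_dep (reindex_onto (fun w => (upd u w x0, proj u w))
  (fun p => upd u p.1 p.2)) /=; last first.
  case=> w x; rewrite andbT => /= /eqP wx0.
  by rewrite upd_upd proj_upd -[in RHS](upd_proj u w) wx0.
apply: eq_big => w; last by rewrite upd_upd upd_proj.
by rewrite proj_upd upd_upd upd_proj !eqxx.
Qed.

(** Fubini at step [k]: overwriting that step exposes its kernel, while causality leaves the earlier
    kernels unchanged. On the right, paths not pinned at [k] have weight zero. *)
Lemma sum_pinned_step (k : 'I_T) (G : W -> R) :
  \sum_w pinned_weight k.+1 w * G w =
  \sum_w pinned_weight k w * \sum_x kap k w x * G (upd k w x).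
Proof.
rewrite (sum_upd k) [RHS](bigID (fun w => proj k w == x0)) /=.
rewrite [X in _ = _ + X]big1 ?addr0 => [|w /negPf wx0]; last first.
  by rewrite /pinned_weight (bigD1 k) //= ltnn wx0 mul0r mulr0 mul0r.
apply: eq_bigr => w wx0; rewrite mulr_sumr; apply: eq_bigr => x _.
rewrite mulrA; congr (_ * _); rewrite /pinned_weight ini_upd -mulrA.
congr (_ * _); rewrite (bigD1 k) //= [in RHS](bigD1 k) //= ltnS leqnn ltnn wx0.
rewrite mul1r mulrC proj_upd kap_upd //; congr (_ * _); apply: eq_bigr => u uk.
rewrite proj_upd_neq // ltnS leq_eqVlt (inj_eq val_inj) (negPf uk) /=.
by case: ifP => // /ltnW u_lt_k; rewrite kap_upd.
Qed.

(** Backward induction from [T]: each step integrates out one kernel of mass 1, at a step that [G]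
    ignores. *)
Lemma sum_path_pinned k (G : W -> R) : (k <= T)%N -> adapted k G ->
  \sum_w path_weight w * G w = \sum_w pinned_weight k w * G w.
Proof.
move=> kT; rewrite -(subKn kT); elim: (T - k)%N => [_|j IH Gk].
  apply: eq_bigr => w _; rewrite subn0; congr (_ * _ * _).
  by apply: eq_bigr => u _; rewrite ltn_ord.
(* Here truncated subtraction makes both cut-offs 0, so nothing remains to be integrated out. *)
have [Tj|jT] := leqP T j.
  apply: etrans (IH _) _; first by move=> u _; apply: Gk; rewrite (eqP (leqW Tj)).
  by rewrite (eqP Tj) (eqP (leqW Tj)).
have uT : (T - j.+1 < T)%N by rewrite ltn_subLR // addSnnS leq_addl.
have uS : (T - j = (Ordinal uT).+1)%N by rewrite /= subnSK.
rewrite IH => [|u uj]; last by apply: Gk; apply: leq_trans uj; rewrite leq_sub.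
rewrite uS sum_pinned_step; apply: eq_bigr => w _; congr (_ * _).
under eq_bigr do rewrite Gk //.
by rewrite -mulr_suml kap1 mul1r.
Qed.

(** Tower property: the steps after [k] are integrated out, step [k] is averaged by its kernel, and
    the steps from [k] on are restored, the new integrand being adapted to [k]. *)
Lemma sum_path_step (k : 'I_T) (G : W -> R) : adapted k.+1 G ->
  \sum_w path_weight w * G w =
  \sum_w path_weight w * \sum_x kap k w x * G (upd k w x).
Proof.
move=> Gk; rewrite (sum_path_pinned (ltn_ord k)) // sum_pinned_step.
rewrite (sum_path_pinned (ltnW (ltn_ord k))) // => u ku w x.
apply: eq_bigr => y _; rewrite kap_upd //; congr (_ * _).
have [-> | uk] := eqVneq u k; first by rewrite upd_upd.
rewrite updC // Gk // ltn_neqAle ku andbT.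
by rewrite (inj_eq val_inj) eq_sym.
Qed.

End SequentialKernels.

(** * Overwriting one value of a finite function *)

Definition ffset (I : finType) (X : Type) (f : {ffun I -> X}) i x :
  {ffun I -> X} := [ffun j => if j == i then x else f j].

Lemma ffset_ffset (I : finType) (X : Type) (f : {ffun I -> X}) i x y :
  ffset (ffset f i x) i y = ffset f i y.
Proof. by apply/ffunP => j; rewrite !ffunE; case: eqP. Qed.

Lemma ffset_id (I : finType) (X : Type) (f : {ffun I -> X}) i :
  ffset f i (f i) = f.
Proof. by apply/ffunP => j; rewrite !ffunE; case: eqP => // ->. Qed.

Lemma ffsetC (I : finType) (X : Type) (f : {ffun I -> X}) i j x y : j != i ->
  ffset (ffset f j x) i y = ffset (ffset f i y) j x.
Proof.
move=> ji; apply/ffunP => k; rewrite !ffunE.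
by case: (eqVneq k i) => // ->; rewrite eq_sym (negPf ji).
Qed.

(** * The trajectory law of a history-dependent policy *)

Section Policy.
Variables (R : realType) (M : nat) (S O A : 'I_M -> finType).
Variables (p0 : forall m, S m -> R) (pe : forall m, S m -> O m -> R).
Variables (pt : forall m, S m -> A m -> S m -> R).
Variables (r : forall m, S m -> A m -> S m -> R).
Variables (q : nat) (D : forall m, A m -> 'I_q -> R) (b : 'I_q -> R) (T : nat).
Hypothesis p0P :
  forall m, (forall s : S m, 0 <= p0 s) /\ \sum_(s : S m) p0 s = 1.
Hypothesis peP :
  forall m (s : S m), (forall o, 0 <= pe s o) /\ \sum_(o : O m) pe s o = 1.
Hypothesis ptP : forall m (s : S m) (a : A m),
  (forall s', 0 <= pt s a s') /\ \sum_(s' : S m) pt s a s' = 1.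
Variables (a0 : JA A).
Hypothesis a0P : feasA D b a0.
Variable pol : 'I_T -> {ffun 'I_T -> JO O} -> {ffun 'I_T -> JA A} -> JA A -> R.
Hypothesis polP : his_policy D b pol.

Implicit Types (s : JS S) (o : JO O) (a : JA A).
Notation feas := (feasA D b).

Definition trajectory : finType :=
  ({ffun 'I_T.+1 -> JS S} * {ffun 'I_T -> JO O} * {ffun 'I_T -> JA A})%type.
(** A step holds the observation and action of a period and the state that follows, so the initial
    state is the only coordinate that no step writes. *)
Definition step : finType := (JO O * JA A * JS S)%type.

Implicit Types (u v : 'I_T) (w : trajectory).

Definition st u w : JS S := w.1.1 (widen_ord (leqnSn T) u).
Definition st' u w : JS S := w.1.1 (lift ord0 u).
Definition ob u w : JO O := w.1.2 u.
Definition ac u w : JA A := w.2 u.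

Lemma st_zero u w : val u = 0%N -> st u w = w.1.1 ord0.
Proof. by move=> u0; congr (w.1.1 _); apply: val_inj. Qed.

Lemma st_succ u v w : val u = v.+1 -> st u w = st' v w.
Proof. by move=> uv; congr (w.1.1 _); apply: val_inj. Qed.

Definition path_step u w : step := (ob u w, ac u w, st' u w).
Definition set_step u w (x : step) : trajectory :=
  (ffset w.1.1 (lift ord0 u) x.2, ffset w.1.2 u x.1.1, ffset w.2 u x.1.2).
(** The drawn observation is written into the path before the policy is consulted, because the
    history of period [u] contains it. This removes the dependence on the old observation of period
    [u], as causality demands. *)
Definition step_kernel u w (x : step) : R :=
  jpe pe (st u w) x.1.1 * pol u (ffset w.1.2 u x.1.1) w.2 x.1.2 *
  jpt pt (st u w) x.1.2 x.2.

Definition prob : trajectory -> R :=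
  path_weight path_step (fun w => jp0 p0 (w.1.1 ord0)) step_kernel.

Definition expect (G : trajectory -> R) : R := \sum_w prob w * G w.

Lemma st_set_step u v w x : (v <= u)%N -> st v (set_step u w x) = st v w.
Proof.
move=> vu; rewrite /st ffunE -(inj_eq val_inj) /= /bump /= add1n.
by rewrite ltn_eqF.
Qed.

Lemma st'_set_step u v w x : v != u -> st' v (set_step u w x) = st' v w.
Proof. by move=> vu; rewrite /st' ffunE (inj_eq lift_inj) (negPf vu). Qed.

Lemma ob_set_step u v w x : v != u -> ob v (set_step u w x) = ob v w.
Proof. by move=> vu; rewrite /ob ffunE (negPf vu). Qed.

Lemma ac_set_step u v w x : v != u -> ac v (set_step u w x) = ac v w.
Proof. by move=> vu; rewrite /ac ffunE (negPf vu). Qed.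

(** If [v = u], the outer [ffset] hides the changed observation and the changed action is not yet
    part of the history; if [v < u], both changes lie in the future. *)
Lemma pol_set_step u v w x o a : (v <= u)%N ->
  pol v (ffset (set_step u w x).1.2 v o) (set_step u w x).2 a =
  pol v (ffset w.1.2 v o) w.2 a.
Proof.
case: polP => _ _ _ pol_na vu; apply: pol_na => i iv.
  rewrite !ffunE; case: eqP => // /eqP i_neq; rewrite ifN //.
  by apply: contraNneq i_neq => iu; rewrite -(inj_eq val_inj) eqn_leq iv iu.
by rewrite ffunE ifN // neq_ltn (leq_trans iv vu).
Qed.

Lemma step_kernel_set_step u v w x : (v <= u)%N ->
  step_kernel v (set_step u w x) =1 step_kernel v w.
Proof.
by move=> vu [[o a] s]; rewrite /step_kernel st_set_step // pol_set_step.
Qed.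

Lemma sum_step_kernel u w (F : step -> R) :
  \sum_x step_kernel u w x * F x =
  \sum_o jpe pe (st u w) o * \sum_a pol u (ffset w.1.2 u o) w.2 a *
    \sum_s jpt pt (st u w) a s * F (o, a, s).
Proof.
transitivity (\sum_o \sum_a \sum_s step_kernel u w (o, a, s) * F (o, a, s)).
  by rewrite !pair_bigA; apply: eq_bigr => -[[o a] s].
apply: eq_bigr => o _; rewrite mulr_sumr; apply: eq_bigr => a _.
by rewrite !mulr_sumr; apply: eq_bigr => s _; rewrite /step_kernel /= !mulrA.
Qed.

Lemma step_kernel1 u w : \sum_x step_kernel u w x = 1.
Proof.
under eq_bigr do rewrite -[step_kernel _ _ _]mulr1.
rewrite (sum_step_kernel u w (fun=> 1)); case: polP => _ _ pol1 _.
under eq_bigr => o _.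
  under eq_bigr do rewrite -mulr_suml (sum_jpt ptP) !mulr1.
  rewrite pol1 mulr1; over.
exact: sum_jpe.
Qed.

Lemma set_step_set_step u w x y : set_step u (set_step u w x) y = set_step u w y.
Proof. by rewrite /set_step /= !ffset_ffset. Qed.

Lemma set_stepC u v w x y : v != u ->
  set_step u (set_step v w x) y = set_step v (set_step u w y) x.
Proof.
move=> vu; rewrite /set_step /= ffsetC ?(inj_eq lift_inj) //.
by congr (_, _, _); exact: ffsetC.
Qed.

Lemma set_step_id u w : set_step u w (path_step u w) = w.
Proof. by rewrite /set_step /= !ffset_id; case: w => [[]]. Qed.

Lemma path_step_set_step u w x : path_step u (set_step u w x) = x.
Proof.
by rewrite /path_step /ob /ac /st' /set_step /= !ffunE !eqxx; case: x => [[]].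
Qed.

Lemma path_step_set_step_neq u v w x : v != u ->
  path_step v (set_step u w x) = path_step v w.
Proof.
by move=> vu; rewrite /path_step ob_set_step // ac_set_step // st'_set_step.
Qed.

Lemma init_set_step u w x : (set_step u w x).1.1 ord0 = w.1.1 ord0.
Proof. by rewrite ffunE. Qed.

(** Pinning needs a default step; a law of mass 1 cannot live on an empty type. *)
Lemma state_inhabited : exists s : JS S, true.
Proof.
have [s _|s0] := pickP (predT : pred (JS S)); first by exists s.
move: (sum_jp0 p0P); rewrite big_pred0 // => /eqP.
by rewrite eq_sym oner_eq0.
Qed.

Lemma obs_inhabited : exists o : JO O, true.
Proof.
have [s _] := state_inhabited.
have [o _|o0] := pickP (predT : pred (JO O)); first by exists o.
move: (sum_jpe peP s); rewrite big_pred0 // => /eqP.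
by rewrite eq_sym oner_eq0.
Qed.

Lemma expect_step u (G : trajectory -> R) : adapted set_step u.+1 G ->
  expect G = expect (fun w =>
    \sum_o jpe pe (st u w) o * \sum_a pol u (ffset w.1.2 u o) w.2 a *
      \sum_s jpt pt (st u w) a s * G (set_step u w (o, a, s))).
Proof.
have [s1 _] := state_inhabited; have [o1 _] := obs_inhabited.
move=> Gu; rewrite /expect /prob.
rewrite (sum_path_step (o1, a0, s1) path_step_set_step path_step_set_step_neq
  set_step_set_step set_stepC set_step_id _ step_kernel_set_step step_kernel1
  Gu) => [|v w x]; last by rewrite init_set_step.
by apply: eq_bigr => w _; rewrite sum_step_kernel.
Qed.

(** With every step pinned, a single path of nonzero weight remains for each initial state. *)
Lemma expect_init (F : JS S -> R) :
  expect (fun w => F (w.1.1 ord0)) = \sum_s jp0 p0 s * F s.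
Proof.
have [s1 _] := state_inhabited; have [o1 _] := obs_inhabited.
rewrite /expect /prob (sum_path_pinned (o1, a0, s1) path_step_set_step
  path_step_set_step_neq set_step_set_step set_step_id _ step_kernel_set_step
  step_kernel1 (leq0n T)) => [|v w x|v _ w x]; rewrite ?init_set_step //.
rewrite (partition_big (fun w : trajectory => w.1.1 ord0) predT) //=.
apply: eq_bigr => s _.
pose ws : trajectory := ([ffun i => if i == ord0 then s else s1], [ffun=> o1], [ffun=> a0]).
rewrite (bigD1 ws) ?ffunE //= [X in _ + X]big1 ?addr0.
  rewrite /pinned_weight /= ffunE eqxx big1 ?mulr1 // => u _.
  by rewrite /path_step /ob /ac /st' /= !ffunE /= !eqxx.
move=> w /andP[/eqP w0 w_ws]; rewrite /pinned_weight.
have [/forallP w_pin|] := boolP [forall u, path_step u w == (o1, a0, s1)].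
  case/eqP: w_ws; case: w w0 w_pin => [[ws' wo] wa] /= w0 w_pin.
  congr (_, _, _); apply/ffunP => i; rewrite !ffunE.
  - by case: (unliftP ord0 i) => [j|] -> /=; [have /eqP[] := w_pin j|].
  - by have /eqP[] := w_pin i.
  - by have /eqP[] := w_pin i.
rewrite negb_forall => /existsP[u /negPf wu].
by rewrite (bigD1 u) //= wu mul0r mulr0 mul0r.
Qed.

Lemma prob_ge0 w : 0 <= prob w.
Proof.
case: polP => pol0 _ _ _; rewrite mulr_ge0 ?(jp0_ge0 p0P) //.
apply: prodr_ge0 => u _; rewrite /step_kernel !mulr_ge0 //.
- exact: jpe_ge0.
- exact: jpt_ge0.
Qed.

Lemma expect_ge0 (G : trajectory -> R) : (forall w, 0 <= G w) -> 0 <= expect G.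
Proof. by move=> G0; apply: sumr_ge0 => w _; rewrite mulr_ge0 ?prob_ge0. Qed.

Lemma expect_sum (I : finType) (F : I -> trajectory -> R) :
  \sum_i expect (F i) = expect (fun w => \sum_i F i w).
Proof. by rewrite exchange_big; apply: eq_bigr => w _; rewrite mulr_sumr. Qed.

Lemma expectZ c (G : trajectory -> R) : c * expect G = expect (fun w => c * G w).
Proof. by rewrite mulr_sumr; apply: eq_bigr => w _; rewrite mulrCA. Qed.

Lemma eq_expect (F G : trajectory -> R) : F =1 G -> expect F = expect G.
Proof. by move=> FG; apply: eq_bigr => w _; rewrite FG. Qed.

(** Conditional law of period [u] given the past: the factor [H], known before that period, comes
    out of the sums. *)
Lemma expect_cond u (H : trajectory -> R) (g : JO O -> JA A -> JS S -> R) :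
  adapted set_step u H ->
  expect (fun w => H w * g (ob u w) (ac u w) (st' u w)) =
  expect (fun w => H w *
    \sum_o jpe pe (st u w) o * \sum_a pol u (ffset w.1.2 u o) w.2 a *
      \sum_s jpt pt (st u w) a s * g o a s).
Proof.
move=> Hu; rewrite (expect_step (u := u)) => [|v uv w x]; last first.
  have uv' : u != v by rewrite neq_ltn uv.
  by rewrite (Hu v (ltnW uv)) (ob_set_step w x uv') (ac_set_step w x uv')
    (st'_set_step w x uv').
apply: eq_expect => w; rewrite mulr_sumr; apply: eq_bigr => o _.
rewrite [RHS]mulrCA; congr (_ * _); rewrite mulr_sumr; apply: eq_bigr => a _.
rewrite [RHS]mulrCA; congr (_ * _); rewrite mulr_sumr; apply: eq_bigr => s _.
rewrite [RHS]mulrCA (Hu u (leqnn u)); congr (_ * (_ * _)).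
by rewrite /ob /ac /st' !ffunE !eqxx.
Qed.

Lemma expect_obs u (H : trajectory -> R) (g : JO O -> R) : adapted set_step u H ->
  expect (fun w => H w * g (ob u w)) =
  expect (fun w => H w * \sum_o jpe pe (st u w) o * g o).
Proof.
move=> Hu; rewrite (expect_cond (fun o _ _ => g o) Hu); apply: eq_expect => w.
congr (_ * _); apply: eq_bigr => o _; congr (_ * _); case: polP => _ _ pol1 _.
under eq_bigr do rewrite -mulr_suml (sum_jpt ptP) mul1r.
by rewrite -mulr_suml pol1 mul1r.
Qed.

(** The emissions of the other components sum to 1, so given the past the observation of component
    [m] depends on its own state alone. *)
Lemma expect_obs_marginal m u (H : trajectory -> R) (x : S m) (y : O m) :
  adapted set_step u H ->
  expect (fun w => H w * (st u w m == x)%:R * (ob u w m == y)%:R) =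
  pe x y * expect (fun w => H w * (st u w m == x)%:R).
Proof.
move=> Hu; rewrite (expect_obs (fun o => (o m == y)%:R)) => [|v uv w z].
  rewrite expectZ; apply: eq_expect => w; rewrite -mulrA [RHS]mulrCA.
  congr (_ * _); case: eqP => [<-|_]; rewrite ?mulr0 ?mul0r // mul1r mulr1.
  rewrite -(jpe_marginal peP) [RHS]big_mkcond; apply: eq_bigr => o _.
  by case: eqP; rewrite ?mulr1 ?mulr0.
by rewrite (Hu v uv) (st_set_step w z uv).
Qed.

(** * The point of the MDP approximation induced by a policy *)

(* Out of range the value still has first marginal [jp0], which
   [mdp_feasible] demands at time 1 even when [T = 0]. *)
Definition policy_mu (t : nat) s a s' : R :=
  if insub t.-1 is Some u
  then expect (fun w => [&& st u w == s, ac u w == a & st' u w == s']%:R)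
  else jp0 p0 s * ((a == a0) && (s == s'))%:R.

Lemma timeP (t : nat) : (1 <= t <= T)%N -> exists u, t = u.+1.
Proof. by case: t => // t tT; exists (Ordinal tT). Qed.

Lemma policy_muS u s a s' : policy_mu u.+1 s a s' =
  expect (fun w => [&& st u w == s, ac u w == a & st' u w == s']%:R).
Proof. by rewrite /policy_mu valK. Qed.

(** The next state is drawn last, by a kernel that sees only the current state and action, so it
    separates from the history. What remains carries the policy, which vanishes at infeasible
    actions. *)
Lemma policy_mu_jpt u s a s' : policy_mu u.+1 s a s' = jpt pt s a s' *
  expect (fun w => (st u w == s)%:R *
    \sum_o jpe pe (st u w) o * pol u (ffset w.1.2 u o) w.2 a).
Proof.
rewrite policy_muS.
transitivity (expect (fun w => (st u w == s)%:R *
    ((a == ac u w) && (s' == st' u w))%:R)).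
  by apply: eq_expect => w; rewrite -natrM mulnb (eq_sym a) (eq_sym s').
rewrite (expect_cond (fun _ a1 s1 => ((a == a1) && (s' == s1))%:R)); last first.
  by move=> v uv w x; rewrite (st_set_step w x uv).
rewrite expectZ; apply: eq_expect => w; rewrite [RHS]mulrCA.
case: eqP => [->|_]; last by rewrite !mul0r.
congr (_ * _); rewrite mulr_sumr; apply: eq_bigr => o _.
rewrite [RHS]mulrCA; congr (_ * _); rewrite (bigD1 a) //= [X in _ + X]big1 ?addr0; last first.
  move=> a1 /negPf a1a; rewrite big1 ?mulr0 // => s1 _.
  by rewrite eq_sym a1a mulr0.
rewrite mulrC (bigD1 s') //= big1 ?addr0 ?eqxx ?mulr1 // => s1 /negPf s1s'.
by rewrite (eq_sym s') s1s' andbF mulr0.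
Qed.

Lemma policy_mu_infeasible u s a s' : ~~ feas a -> policy_mu u.+1 s a s' = 0.
Proof.
case: polP => _ pol_feas _ _ aF; rewrite policy_mu_jpt /expect big1 ?mulr0 // => w _.
by rewrite big1 ?mulr0 // => o _; rewrite pol_feas ?mulr0.
Qed.

(** Restricting the sum to feasible actions loses nothing, as the others have probability 0. *)
Lemma mdp_exp_policy_mu u (F : JS S -> JA A -> JS S -> R) :
  mdp_exp D b policy_mu u.+1 F =
  expect (fun w => F (st u w) (ac u w) (st' u w)).
Proof.
transitivity (\sum_s \sum_a \sum_s' policy_mu u.+1 s a s' * F s a s').
  apply: eq_bigr => s _; rewrite big_mkcond; apply: eq_bigr => a _.
  case: ifPn => // aF; rewrite big1 // => s' _.
  by rewrite policy_mu_infeasible ?mul0r.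
under eq_bigr do under eq_bigr do under eq_bigr do
  rewrite policy_muS mulrC expectZ.
under eq_bigr do under eq_bigr do rewrite expect_sum.
under eq_bigr do rewrite expect_sum.
by rewrite expect_sum; apply: eq_expect => w; rewrite sum3_indicator.
Qed.

Lemma sum_policy_mu u s : \sum_(a | feas a) \sum_s' policy_mu u.+1 s a s' =
  expect (fun w => (st u w == s)%:R).
Proof.
rewrite -(mdp_exp_policy_mu u (fun s1 _ _ => (s1 == s)%:R)) /mdp_exp.
rewrite [RHS](bigD1 s) //= [X in _ = _ + X]big1 ?addr0 => [|s1 /negPf s1s].
  by apply: eq_bigr => a _; apply: eq_bigr => s' _; rewrite eqxx mulr1.
by rewrite big1 // => a _; rewrite big1 // => s' _; rewrite s1s mulr0.
Qed.

Lemma mdp_feasible_policy_mu : mdp_feasible p0 pt D b T (jp0 p0) policy_mu.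
Proof.
split.
- by move=> s; split=> //; exact: jp0_ge0.
- move=> t /timeP[u ->] s a s' _; rewrite policy_muS; apply: expect_ge0 => w.
  exact: ler0n.
- move=> s; have [T0|T_gt0] := leqP T 0.
    rewrite (bigD1 a0) //= [X in _ + X]big1 ?addr0 => [|a /andP[_ /negPf aa0]].
      rewrite /policy_mu insubN -?leqNgt //=.
      under eq_bigr do rewrite eqxx.
      by rewrite -mulr_sumr (sum_indicator _ true) mulr1.
    rewrite big1 // => s' _.
    by rewrite /policy_mu insubN -?leqNgt //= aa0 mulr0.
  rewrite (sum_policy_mu (Ordinal T_gt0)).
  transitivity (expect (fun w => (w.1.1 ord0 == s)%:R)).
    by apply: eq_expect => w; rewrite st_zero.
  rewrite (expect_init (fun s1 => (s1 == s)%:R)) (bigD1 s) //= eqxx mulr1.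
  by rewrite big1 ?addr0 // => s1 /negPf ->; rewrite mulr0.
(* Inflow and outflow are the law of one coordinate of the trajectory: the state after a period is
   the state before the next. *)
- move=> [//|[//|t]] /= tT s.
  rewrite (sum_policy_mu (Ordinal tT)).
  transitivity (mdp_exp D b policy_mu t.+1 (fun _ _ s' => (s' == s)%:R)).
    rewrite (mdp_exp_policy_mu (Ordinal (ltnW tT)) (fun _ _ s' => (s' == s)%:R)).
    by apply: eq_expect => w; rewrite (@st_succ _ (Ordinal (ltnW tT))).
  apply: eq_bigr => s'' _; apply: eq_bigr => a _.
  by rewrite (bigD1 s) //= eqxx mulr1 big1 ?addr0 // => s' /negPf ->; rewrite mulr0.
- move=> t /timeP[u ->] s a s' _; rewrite [LHS]policy_mu_jpt; congr (_ * _).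
  under eq_bigr do rewrite policy_mu_jpt.
  by rewrite -mulr_suml (sum_jpt ptP) mul1r.
Qed.

Lemma mdp_obj_policy_mu :
  mdp_obj r D b T policy_mu = his_value p0 pe pt r pol.
Proof.
transitivity (\sum_u expect (fun w => jr r (st u w) (ac u w) (st' u w))).
  rewrite /mdp_obj big_add1 big_mkord; apply: eq_bigr => u _.
  rewrite -(mdp_exp_policy_mu u (jr r)); apply: eq_bigr => s _.
  apply: eq_bigr => a _; apply: eq_bigr => s' _; exact: mulrC.
(* On a fixed trajectory [step_kernel] writes back the observation already there, so [prob] is the
   weight in [his_value]. *)
rewrite expect_sum /his_value !pair_bigA; apply: eq_bigr => -[[s o] a] _ /=.
congr (_ * _); rewrite /prob /path_weight /=; congr (_ * _).
by apply: eq_bigr => u _; rewrite /step_kernel /ob /ac /st /st' /= ffset_id.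
Qed.

(** * Trajectory marginals satisfying the constraints of R^c *)

Definition policy_soa m (t : nat) (x : S m) (y : O m) (z : A m) : R :=
  if insub t.-1 is Some u
  then expect (fun w => [&& st u w m == x, ob u w m == y & ac u w m == z]%:R)
  else 0.

Definition policy_sasoa m (t : nat) (x' : S m) (z' : A m) (x : S m) (y : O m)
    (z : A m) : R :=
  if (insub t.-2, insub t.-1) is (Some v, Some u)
  then expect (fun w => ((st v w m == x') && (ac v w m == z'))%:R *
    [&& st u w m == x, ob u w m == y & ac u w m == z]%:R)
  else 0.

Lemma policy_soaS m u (x : S m) y z : policy_soa u.+1 x y z =
  expect (fun w => [&& st u w m == x, ob u w m == y & ac u w m == z]%:R).
Proof. by rewrite /policy_soa valK. Qed.

Lemma policy_sasoaS m u v (x' : S m) z' x y z : val u = v.+1 ->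
  policy_sasoa u.+1 x' z' x y z =
  expect (fun w => ((st v w m == x') && (ac v w m == z'))%:R *
    [&& st u w m == x, ob u w m == y & ac u w m == z]%:R).
Proof. by move=> uv; rewrite /policy_sasoa valK /= uv valK. Qed.

Lemma sas_marginal_policy_mu m u (x : S m) y z :
  sas_marginal D b policy_mu u.+1 x y z =
  expect (fun w => [&& st u w m == x, ac u w m == y & st' u w m == z]%:R).
Proof.
exact: (mdp_exp_policy_mu u
  (fun s a s' => [&& s m == x, a m == y & s' m == z]%:R)).
Qed.

Lemma policy_relax_feasible : exists del,
  relax_feasible p0 pe pt D b T p0 policy_soa
    (fun m => @sas_marginal _ _ _ _ _ D b policy_mu m) del.
Proof.
apply: (relax_feasible_sas_marginal p0P peP ptP (ex_intro _ a0 a0P)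
  mdp_feasible_policy_mu).
- move=> m t /timeP[u ->] x y z; rewrite policy_soaS; apply: expect_ge0 => w.
  exact: ler0n.
- move=> m t /timeP[u ->] x z; rewrite sas_marginal_sum3.
  rewrite (mdp_exp_policy_mu u (fun s a _ => ((s m == x) && (a m == z))%:R)).
  under eq_bigr do rewrite policy_soaS.
  rewrite expect_sum; apply: eq_expect => w.
  under eq_bigr do rewrite andbCA andbC.
  by rewrite sum_indicator.
- move=> m t /timeP[u ->] x y; rewrite sas_marginal_sum23.
  rewrite (mdp_exp_policy_mu u (fun s _ _ => (s m == x)%:R)).
  have H1 : adapted set_step u (fun=> 1 : R) by [].
  have := expect_obs_marginal x y H1.
  under [in RHS]eq_expect do rewrite mul1r.
  move=> <-; under eq_bigr do rewrite policy_soaS.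
  rewrite expect_sum; apply: eq_expect => w; rewrite mul1r -natrM mulnb.
  by under eq_bigr do rewrite andbA; rewrite sum_indicator.
Qed.

(** Transition and emission factor over components: component [m], held at [x], gives the displayed
    factor, and the others are summed out to a quantity free of [x]. *)
Lemma sum_next_state m s a (x : S m) o (c : R) :
  \sum_(s' : JS S) jpt pt s a s' * ((s' m == x)%:R * (jpe pe s' o * c)) =
  pe x (o m) * pt (s m) (a m) x *
    (c * \prod_(n | n != m) \sum_k pt (s n) (a n) k * pe k (o n)).
Proof.
transitivity (c * \sum_(s' : JS S | s' m == x)
    \prod_n (pt (s n) (a n) (s' n) * pe (s' n) (o n))).
  rewrite [in RHS]big_mkcond mulr_sumr; apply: eq_bigr => s' _.
  by case: eqP => _; [rewrite mul1r mulrA mulrC -big_split|rewrite mul0r !mulr0].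
rewrite (sum_dffun_prod_fix (fun n k => pt (s n) (a n) k * pe k (o n))).
by rewrite mulrCA [pe x _ * _]mulrC.
Qed.

(* The factor [f] does not depend on [x]: this is the conditional independence
   behind the last constraint of R^c. *)
Lemma policy_sasoa_factor m u v (x' : S m) z' y z : val u = v.+1 ->
  exists f, forall x,
    policy_sasoa u.+1 x' z' x y z = pe x y * pt x' z' x * f.
Proof.
move=> uv.
(* [Q] is the part of period [u] that sees no state: [o] shows [y], and the policy then plays [z] in
   component [m]. *)
pose Q (oo : {ffun 'I_T -> JO O}) aa o := (o m == y)%:R *
  \sum_a pol u (ffset oo u o) aa a * (a m == z)%:R.
(* Likelihood of the observations of the other components, given the previous state and action. *)
pose rest s a o := \prod_(n | n != m) \sum_k pt (s n) (a n) k * pe k (o n).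
exists (expect (fun w => \sum_o1 jpe pe (st v w) o1 *
  \sum_a1 pol v (ffset w.1.2 v o1) w.2 a1 *
  (((st v w m == x') && (a1 m == z'))%:R *
   \sum_o Q (ffset w.1.2 v o1) (ffset w.2 v a1) o * rest (st v w) a1 o))) => x.
rewrite (policy_sasoaS _ _ _ _ _ uv).
pose G w := ((st v w m == x') && (ac v w m == z'))%:R * ((st' v w m == x)%:R *
  \sum_o jpe pe (st' v w) o * Q w.1.2 w.2 o).
have vu (w' : nat) : (u <= w')%N -> (v < w')%N by rewrite uv.
(* First period [u] is integrated out; its state stays as the state after period [v]. *)
transitivity (expect G).
  pose H w := ((st v w m == x') && (ac v w m == z'))%:R * (st u w m == x)%:R : R.
  transitivity (expect (fun w => H w * ((ob u w m == y) && (ac u w m == z))%:R)).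
    by apply: eq_expect => w; rewrite /H -mulrA -!natrM !mulnb.
  rewrite (expect_cond (fun o a _ => ((o m == y) && (a m == z))%:R)); last first.
    move=> w' uw' w x1; have vw' := vu _ uw'.
    by rewrite /H st_set_step ?(ltnW vw') // ac_set_step ?st_set_step // neq_ltn vw'.
  apply: eq_expect => w; rewrite /H /G -mulrA -(st_succ w uv).
  congr (_ * (_ * _)); apply: eq_bigr => o _; congr (_ * _).
  rewrite /Q mulr_sumr; apply: eq_bigr => a _.
  rewrite -mulr_suml (sum_jpt ptP) mul1r mulrCA; congr (_ * _).
  by rewrite -natrM mulnb.
(* Integrating out period [v] makes the law of that state explicit, ready for [sum_next_state]. *)
rewrite (expect_step (u := v)) => [|w' vw' w x1]; last first.
  have vw : v != w' by rewrite neq_ltn vw'.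
  rewrite /G st_set_step ?(ltnW vw') // ac_set_step // st'_set_step //.
  congr (_ * (_ * _)); apply: eq_bigr => o _; congr (_ * (_ * _)).
  by apply: eq_bigr => a _; rewrite pol_set_step // uv.
rewrite expectZ; apply: eq_expect => w; rewrite mulr_sumr; apply: eq_bigr => o1 _.
rewrite [RHS]mulrCA; congr (_ * _); rewrite mulr_sumr; apply: eq_bigr => a1 _.
rewrite [RHS]mulrCA; congr (_ * _).
transitivity (((st v w m == x') && (a1 m == z'))%:R *
    \sum_o \sum_s jpt pt (st v w) a1 s * ((s m == x)%:R *
      (jpe pe s o * Q (ffset w.1.2 v o1) (ffset w.2 v a1) o))).
  rewrite exchange_big mulr_sumr; apply: eq_bigr => s _ /=.
  rewrite /G st_set_step // /ac /st' /= !ffunE !eqxx mulrCA -mulr_sumr.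
  by rewrite -mulr_sumr.
case: andP => [[/eqP <- /eqP <-]|_]; last by rewrite !mul0r mulr0.
rewrite !mul1r mulr_sumr; apply: eq_bigr => o _; rewrite sum_next_state /Q.
by case: eqP => [->|_]; rewrite // !mul0r !mulr0.
Qed.

Lemma policy_Rc_extra m : Rc_extra (@pe m) (@pt m) T (@policy_soa m)
  (@sas_marginal _ _ _ _ _ D b policy_mu m) (@policy_sasoa m).
Proof.
move=> t /andP[t2 tT].
have [u ut] : exists u, t = u.+1 by apply: timeP; rewrite ltnW.
have [v vt] : exists v, t.-1 = v.+1.
  by apply: timeP; case: t t2 tT {ut} => [|[|t]] //= _ /ltnW.
have uv : val u = v.+1 by rewrite -vt ut.
rewrite vt ut; split.
- move=> x' z' x y z; rewrite (policy_sasoaS _ _ _ _ _ uv); apply: expect_ge0 => w.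
  by rewrite mulr_ge0 ?ler0n.
- move=> x y z; under eq_bigr do under eq_bigr do rewrite (policy_sasoaS _ _ _ _ _ uv).
  under eq_bigr do rewrite expect_sum.
  rewrite expect_sum policy_soaS; apply: eq_expect => w.
  under eq_bigr do rewrite -mulr_suml sum_indicator.
  rewrite -mulr_suml (_ : \sum_x' _ = 1) ?mul1r //.
  by rewrite (sum_indicator _ true).
- move=> x' z' x y; under eq_bigr do rewrite (policy_sasoaS _ _ _ _ _ uv).
  rewrite expect_sum -mulrA.
  rewrite -(sas_marginal_pt ptP mdp_feasible_policy_mu) ?ltn_ord //.
  rewrite sas_marginal_policy_mu.
  pose H w := ((st v w m == x') && (ac v w m == z'))%:R : R.
  have Hu : adapted set_step u H.
    move=> w' uw' w x1; have vw' : (v < w')%N by rewrite -uv.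
    by rewrite /H st_set_step ?(ltnW vw') // ac_set_step // neq_ltn vw'.
  transitivity (pe x y * expect (fun w => H w * (st u w m == x)%:R)).
    rewrite -(expect_obs_marginal _ _ Hu); apply: eq_expect => w.
    rewrite -mulr_sumr -mulrA; congr (_ * _); rewrite -natrM mulnb.
    by under eq_bigr do rewrite andbA; rewrite sum_indicator.
  congr (_ * _); apply: eq_expect => w.
  by rewrite /H (st_succ w uv) -natrM mulnb andbA.
- move=> x' z' x y z; have [f tcE] := policy_sasoa_factor x' z' y z uv.
  (* Both sides share the factor [f], and [N] is the normaliser of [pcond]. If [N = 0], all its
     nonnegative terms vanish, so the convention for division by 0 gives the right value. *)
  under eq_bigr do rewrite tcE; rewrite tcE -mulr_suml /pcond mulrA.
  set N := \sum_x1 _; have [N0|N_neq0] := eqVneq N 0; last by rewrite divfK.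
  suff -> : pe x y * pt x' z' x = 0 by rewrite !mul0r.
  move/eqP: N0; rewrite psumr_eq0 => [/allP/(_ x)|x1 _].
    by rewrite mem_index_enum => /(_ isT)/eqP.
  by rewrite mulr_ge0 ?(peP _).1 ?(ptP _ _).1.
Qed.

End Policy.

(** * Comparison of the optimal values *)

Theorem mainTheorem4 (R : realType) (M : nat) (S O A : 'I_M -> finType)
  (p0 : forall m, S m -> R) (pe : forall m, S m -> O m -> R)
  (pt : forall m, S m -> A m -> S m -> R) (r : forall m, S m -> A m -> S m -> R)
  (q : nat) (D : forall m, A m -> 'I_q -> R) (b : 'I_q -> R) (T : nat)
  (Hp0 : forall m, (forall s, 0 <= p0 m s) /\ \sum_(s : S m) p0 m s = 1)
  (Hpe : forall m (s : S m), (forall o, 0 <= pe m s o) /\ \sum_(o : O m) pe m s o = 1)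
  (Hpt : forall m (s : S m) (a : A m),
      (forall s', 0 <= pt m s a s') /\ \sum_(s' : S m) pt m s a s' = 1)
  (Hb : forall i, 0 <= b i)
  (HXA : exists a : JA A, feasA D b a) :
  (forall (mu1 : JS S -> R) (mu : nat -> JS S -> JA A -> JS S -> R),
     mdp_feasible p0 pt D b T mu1 mu ->
     exists tau1 tsoa tsas del,
       relax_feasible p0 pe pt D b T tau1 tsoa tsas del /\
       relax_obj r T tsas = mdp_obj r D b T mu) /\
  (v_MDP p0 pt r D b T <= z_R p0 pe pt r D b T)%E /\
  (v_his p0 pe pt r D b T <= z_Rc p0 pe pt r D b T)%E /\
  (z_Rc p0 pe pt r D b T <= z_R p0 pe pt r D b T)%E.
Proof.
have mdp_case mu1 mu : mdp_feasible p0 pt D b T mu1 mu ->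
    exists tau1 tsoa tsas del,
      relax_feasible p0 pe pt D b T tau1 tsoa tsas del /\
      relax_obj r T tsas = mdp_obj r D b T mu.
  move=> muP; have [tsoa [del feas]] := mdp_relaxation Hp0 Hpe Hpt HXA muP.
  exists p0, tsoa, (fun m => @sas_marginal _ _ _ _ _ D b mu m), del.
  by split=> //; exact: relax_obj_sas_marginal.
split=> //; split; [|split].
- apply: ge_ereal_sup => _ [_ [mu1 [mu [muP ->]]] <-].
  have [tau1 [tsoa [tsas [del [feas obj]]]]] := mdp_case _ _ muP.
  apply: ereal_sup_ubound; exists (mdp_obj r D b T mu) => //.
  by exists tau1, tsoa, tsas, del.
- apply: ge_ereal_sup => _ [_ [pol [polP ->]] <-].
  have [a0 a0P] := HXA.
  have [del feas] := policy_relax_feasible Hp0 Hpe Hpt a0P polP.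
  apply: ereal_sup_ubound; exists (his_value p0 pe pt r pol) => //.
  exists p0, (@policy_soa _ _ _ _ _ p0 pe pt _ pol),
    (fun m => @sas_marginal _ _ _ _ _ D b (policy_mu p0 pe pt a0 pol) m), del,
    (@policy_sasoa _ _ _ _ _ p0 pe pt _ pol).
  split=> //; first by move=> m; apply: policy_Rc_extra.
  by rewrite relax_obj_sas_marginal mdp_obj_policy_mu.
- apply: ereal_sup_le => _ [z [tau1 [tsoa [tsas [del [tc [feas _ zE]]]]]] <-].
  by exists z => //; exists tau1, tsoa, tsas, del.
Qed.
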